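(* Let $T$ be a complete dependent theory with monster model $\mathfrak{C}$, let $A\subseteq\mathfrak{C}$ be a (small) set and let $N\supseteq A$ be a model which is $(|A|+|T|)^+$-saturated. Then: (i) A type $p\in S(N)$ is strictly free over $A$ if and only if for every $a\models p$ both of the following hold: $\mathrm{tp}(a/N)$ does not fork over $A$, and $\mathrm{tp}(N/Aa)$ does not divide over $A$. (ii) If $p\in S(N)$ is an heir of $p\restriction A$ and does not fork over $A$, then $p$ is strictly free over $A$. In particular this is the case if $p$ is both an heir and a co-heir of $p\restriction A$.
   Context: $T$ is a complete dependent (NIP) first-order theory, $T=T^{eq}$, with monster model $\mathfrak{C}$. A global type is a complete type over $\mathfrak{C}$ (its realizations lie in a larger monster model). For sets $A\subseteq B$, a type $p\in S(B)$ is a strictly nondividing extension of $p\restriction A$ if for every $a\models p$: $\mathrm{tp}(a/B)$ does not divide over $A$, and $\mathrm{tp}(B/Aa)$ does not divide over $A$. A type $p\in S(B)$ is strictly free (strictly nonforking) over $A$ if there is a global type $q$ extending $p$ which is a strictly nondividing extension of $p\restriction A$. For $A\subseteq B$, $p\in S(B)$ is an heir of $p\restriction A$ if for every formula $\varphi(x,y)$ over $A$ and $c\in B$ with $\varphi(x,c)\in p$ there is $c'\in A$ with $\varphi(x,c')\in p$; $p$ is a co-heir of $p\restriction A$ if $p$ is finitely satisfiable in $A$. *)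

(* Defs.v *)
From mathcomp Require Import all_boot.
From mathcomp Require Import boolp classical_sets functions cardinality.

Set Implicit Arguments.
Unset Strict Implicit.
Unset Printing Implicit Defensive.

Local Open Scope classical_set_scope.
Local Open Scope card_scope.

(* The cardinal of a set; a cardinal kappa is given as a type, used as [set: kappa]. *)
Definition card_lt (S U : Type) (A : set S) (B : set U) : Prop :=
  A #<= B /\ ~ (B #<= A).

(** * Many-sorted first-order logic *)

Record language := Language {
  lsort : Type;
  funsym : Type;
  farity : funsym -> nat;
  fdom : forall f : funsym, 'I_(farity f) -> lsort;
  fcod : funsym -> lsort;
  relsym : Type;
  rarity : relsym -> nat;
  rdom : forall r : relsym, 'I_(rarity r) -> lsort }.

(* A context is a (possibly infinite) family of sorted variables. *)
Record ctx (L : language) := Ctx { var :> Type; vsort : var -> lsort L }.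

Record fctx (L : language) := Fctx {
  fsize : nat;
  fsort : 'I_fsize -> lsort L }.

Coercion ctx_of_fctx (L : language) (F : fctx L) : ctx L := Ctx (@fsort L F).

Definition csum (L : language) (G H : ctx L) : ctx L :=
  Ctx (fun v : G + H => match v with inl x => vsort x | inr y => vsort y end).

Definition fsum (L : language) (F F' : fctx L) : fctx L :=
  Fctx (fun i : 'I_(fsize F + fsize F') =>
    match fintype.split i with inl x => fsort x | inr y => fsort y end).

Definition cext (L : language) (G : ctx L) (s : lsort L) : ctx L :=
  Ctx (fun v : option G => if v is Some x then vsort x else s).

Definition cempty (L : language) : ctx L :=
  Ctx (fun v : Empty_set => match v with end : lsort L).

Definition csort (L : language) (s : lsort L) : ctx L := Ctx (fun _ : unit => s).

Inductive term (L : language) (G : ctx L) : lsort L -> Type :=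
| Var (v : G) : term G (vsort v)
| App (f : funsym L) (ts : forall i : 'I_(farity f), term G (fdom i)) :
    term G (fcod f).

(* [All] binds the variable [None] of the extended context. *)
Inductive formula (L : language) (G : ctx L) : Type :=
| Eq (s : lsort L) (t u : term G s)
| Rel (r : relsym L) (ts : forall i : 'I_(rarity r), term G (rdom i))
| Bot
| Imp (phi psi : formula G)
| All (s : lsort L) (phi : formula (cext G s)).

Definition Neg (L : language) (G : ctx L) (phi : formula G) : formula G :=
  Imp phi (Bot G).

Record structure (L : language) := Structure {
  carrier :> lsort L -> Type;
  carrier_inhabited : forall s, inhabited (carrier s);
  funI : forall f : funsym L,
    (forall i : 'I_(farity f), carrier (fdom i)) -> carrier (fcod f);
  relI : forall r : relsym L,
    (forall i : 'I_(rarity r), carrier (rdom i)) -> Prop }.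

Definition assign (L : language) (M : structure L) (G : ctx L) : Type :=
  forall v : G, M (vsort v).

Definition tcat (L : language) (M : structure L) (G H : ctx L)
    (a : assign M G) (b : assign M H) : assign M (csum G H) :=
  fun v => match v with inl x => a x | inr y => b y end.

Definition fcat (L : language) (M : structure L) (F F' : fctx L)
    (a : assign M F) (b : assign M F') : assign M (fsum F F') :=
  fun i =>
    match fintype.split i as u
      return M (match u with inl x => fsort x | inr y => fsort y end)
    with inl x => a x | inr y => b y end.

Definition tpush (L : language) (M : structure L) (G : ctx L) (s : lsort L)
    (a : assign M G) (m : M s) : assign M (cext G s) :=
  fun v => match v with Some x => a x | None => m end.

Definition tempty (L : language) (M : structure L) : assign M (cempty L) :=
  fun v => match v with end.

Definition tsingle (L : language) (M : structure L) (s : lsort L) (m : M s) :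
  assign M (csort s) := fun _ => m.

Definition tmap (L : language) (M N : structure L)
    (f : forall s, M s -> N s) (G : ctx L) (a : assign M G) : assign N G :=
  fun v => f _ (a v).

Fixpoint eval (L : language) (M : structure L) (G : ctx L) (a : assign M G)
    (s : lsort L) (t : term G s) : M s :=
  match t with
  | Var v => a v
  | App f ts => funI (fun i => eval a (ts i))
  end.

Fixpoint sat (L : language) (M : structure L) (G : ctx L) (phi : formula G) :
    assign M G -> Prop :=
  match phi with
  | Eq s t u => fun a => eval a t = eval a u
  | Rel r ts => fun a => relI (fun i => eval a (ts i))
  | Bot => fun _ => False
  | Imp phi psi => fun a => sat phi a -> sat psi a
  | All s phi => fun a => forall m : M s, sat phi (tpush a m)
  end.

(** * Theories *)

Definition sentence (L : language) := formula (cempty L).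

Definition model (L : language) (T : set (sentence L)) (M : structure L) :=
  forall phi, T phi -> sat phi (tempty M).

Definition entails (L : language) (T : set (sentence L)) (phi : sentence L) :=
  forall M : structure L, model T M -> sat phi (tempty M).

Definition complete_theory (L : language) (T : set (sentence L)) : Prop :=
  (exists M : structure L, model T M) /\
  (forall phi, entails T phi \/ entails T (Neg phi)).

(* The cardinal |T| = |L| + aleph_0. *)
Definition theory_card (L : language) : Type :=
  (lsort L + funsym L + relsym L + nat)%type.

(* No formula phi(x, y) has the independence property. *)
Definition dependent (L : language) (T : set (sentence L)) : Prop :=
  forall (X Y : fctx L) (phi : formula (csum X Y)),
    ~ exists M : structure L, model T M /\
      exists (a : nat -> assign M X) (b : set nat -> assign M Y),
        forall (i : nat) (I : set nat), sat phi (tcat (a i) (b I)) <-> I i.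

Definition definable_equivalence (L : language) (T : set (sentence L))
    (F : fctx L) (E : formula (csum F F)) : Prop :=
  forall M : structure L, model T M ->
    [/\ forall a : assign M F, sat E (tcat a a),
        forall a b : assign M F, sat E (tcat a b) -> sat E (tcat b a)
      & forall a b c : assign M F,
          sat E (tcat a b) -> sat E (tcat b c) -> sat E (tcat a c)].

(* T = T^eq, up to interdefinability: every 0-definable quotient of a finite
   product of sorts is already a sort, via a 0-definable projection pi. *)
Definition eq_closed (L : language) (T : set (sentence L)) : Prop :=
  forall (F : fctx L) (E : formula (csum F F)), definable_equivalence T E ->
    exists (s : lsort L) (P : formula (csum F (csort s))),
      forall M : structure L, model T M ->
        exists pi : assign M F -> M s,
          [/\ forall a m, sat P (tcat a (tsingle m)) <-> pi a = m,
              forall m, exists a, pi a = m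
            & forall a b, pi a = pi b <-> sat E (tcat a b)].

(** * Sets, formulas with parameters and types

   From here on [M] is an ambient structure containing everything. *)

Definition elt (L : language) (M : structure L) := {s : lsort L & M s}.

Definition rng (L : language) (M : structure L) (G : ctx L) (a : assign M G) :
  set (elt M) := [set x | exists v : G, x = existT _ (vsort v) (a v)].

(* A set as an (infinite) tuple enumerating itself. *)
Definition set_ctx (L : language) (M : structure L) (B : set (elt M)) : ctx L :=
  Ctx (fun b : {x : elt M | B x} => projT1 (sval b)).

Definition set_tuple (L : language) (M : structure L) (B : set (elt M)) :
  assign M (set_ctx B) := fun b => projT2 (sval b).

(* A formula phi(x, b) with an explicit finite tuple b of parameters. *)
Record pformula (L : language) (M : structure L) (X : ctx L) := Pformula {
  pctx : fctx L;
  pbody : formula (csum X pctx);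
  ppar : assign M pctx }.

Definition holds (L : language) (M : structure L) (X : ctx L)
    (phi : pformula M X) (a : assign M X) : Prop :=
  sat (pbody phi) (tcat a (@ppar _ _ _ phi)).

Definition pneg (L : language) (M : structure L) (X : ctx L)
    (phi : pformula M X) : pformula M X :=
  Pformula (Neg (pbody phi)) (@ppar _ _ _ phi).

Definition over (L : language) (M : structure L) (X : ctx L)
    (B : set (elt M)) : set (pformula M X) :=
  [set phi | rng (@ppar _ _ _ phi) `<=` B].

Definition finitely_satisfiable_in (L : language) (M : structure L) (X : ctx L)
    (A : set (elt M)) (p : set (pformula M X)) : Prop :=
  forall (d : nat) (phi : 'I_d -> pformula M X), (forall l, p (phi l)) ->
    exists a : assign M X, rng a `<=` A /\ forall l, holds (phi l) a.

(* The complete types over B; consistency is relative to the elementary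
   diagram of M. *)
Definition complete_type (L : language) (M : structure L) (X : ctx L)
    (B : set (elt M)) : set (set (pformula M X)) :=
  [set p | [/\ p `<=` over B, finitely_satisfiable_in setT p
             & forall phi, over B phi -> p phi \/ p (pneg phi)]].

Definition tp (L : language) (M : structure L) (X : ctx L) (a : assign M X)
    (B : set (elt M)) : set (pformula M X) :=
  [set phi | over B phi /\ holds phi a].

Definition realizes (L : language) (M : structure L) (X : ctx L)
    (a : assign M X) (p : set (pformula M X)) : Prop :=
  forall phi, p phi -> holds phi a.

(** * Elementary submodels, saturation, monster models *)

Definition elementary_embedding (L : language) (N M : structure L)
    (f : forall s, N s -> M s) : Prop :=
  forall (G : fctx L) (phi : formula G) (a : assign N G),
    sat phi a <-> sat phi (tmap f a).

(* N is the universe of an elementary substructure of M. *)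
Definition elementary_sub (L : language) (M : structure L)
    (N : set (elt M)) : Prop :=
  exists (N0 : structure L) (f : forall s, N0 s -> M s),
    elementary_embedding f /\
    N = [set x | exists (s : lsort L) (n : N0 s), x = existT _ s (f s n)].

Definition realizes_types_over (L : language) (M : structure L)
    (N B : set (elt M)) : Prop :=
  forall (X : fctx L) (p : set (pformula M X)), complete_type B p ->
    exists a : assign M X, rng a `<=` N /\ realizes a p.

Definition saturated (L : language) (M : structure L) (N : set (elt M))
    (kappa : Type) : Prop :=
  forall B : set (elt M), B `<=` N -> card_lt B [set: kappa] ->
    realizes_types_over N B.

(* lambda^+-saturation. *)
Definition succ_saturated (L : language) (M : structure L) (N : set (elt M))
    (lambda : Type) : Prop :=
  forall B : set (elt M), B `<=` N -> B #<= [set: lambda] ->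
    realizes_types_over N B.

(* f restricts to an automorphism of the elementary substructure N of M. *)
Definition automorphism_of (L : language) (M : structure L) (N : set (elt M))
    (f : forall s, M s -> M s) : Prop :=
  (forall (G : fctx L) (phi : formula G) (a : assign M G), rng a `<=` N ->
     (sat phi a <-> sat phi (tmap f a))) /\
  [set existT _ (projT1 x) (f _ (projT2 x)) | x in N] = N.

Definition strongly_homogeneous (L : language) (M : structure L)
    (N : set (elt M)) (kappa : Type) : Prop :=
  forall (G : ctx L) (a b : assign M G), card_lt [set: G] [set: kappa] ->
    rng a `<=` N -> rng b `<=` N -> tp a set0 = tp b set0 ->
    exists f : forall s, M s -> M s,
      automorphism_of N f /\ forall v : G, f _ (a v) = b v.

(* N, an elementary substructure of M, is a monster model, where "small" means
   "of cardinality less than kappa". *)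
Definition monster (L : language) (M : structure L) (N : set (elt M))
    (kappa : Type) : Prop :=
  [/\ elementary_sub N, card_lt [set: theory_card L] [set: kappa],
      saturated N kappa & strongly_homogeneous N kappa].

(** * Dividing and forking

   [M] is assumed to be a monster model in which all the sets occurring below
   are small. *)

Definition formula_divides (L : language) (M : structure L) (X : ctx L)
    (A : set (elt M)) (phi : pformula M X) : Prop :=
  exists (k : nat) (b : nat -> assign M (pctx phi)),
    (forall i, tp (b i) A = tp (@ppar _ _ _ phi) A) /\
    (forall j : 'I_k -> nat, injective j ->
       ~ exists a : assign M X, forall l, sat (pbody phi) (tcat a (b (j l)))).

Definition implies (L : language) (M : structure L) (X : ctx L)
    (p : set (pformula M X)) (D : set (assign M X)) : Prop :=
  exists (d : nat) (phi : 'I_d -> pformula M X), (forall l, p (phi l)) /\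
    forall a : assign M X, (forall l, holds (phi l) a) -> D a.

Definition divides (L : language) (M : structure L) (X : ctx L)
    (A : set (elt M)) (p : set (pformula M X)) : Prop :=
  exists phi : pformula M X, formula_divides A phi /\ implies p (holds phi).

Definition forks (L : language) (M : structure L) (X : ctx L)
    (A : set (elt M)) (p : set (pformula M X)) : Prop :=
  exists (d : nat) (phi : 'I_d -> pformula M X),
    (forall l, formula_divides A (phi l)) /\
    implies p [set a | exists l, holds (phi l) a].

(* [p], a type over [B], is a strictly nondividing extension of its restriction
   to [A]. *)
Definition strictly_nondividing (L : language) (M : structure L) (X : ctx L)
    (A B : set (elt M)) (p : set (pformula M X)) : Prop :=
  forall a : assign M X, realizes a p ->
    ~ divides A (tp a B) /\ ~ divides A (tp (set_tuple (B := B)) (A `|` rng a)).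

(* Global types are the types over the monster [C]; they are realized in the
   larger monster [M]. *)
Definition strictly_free (L : language) (M : structure L) (C : set (elt M))
    (X : ctx L) (A : set (elt M)) (p : set (pformula M X)) : Prop :=
  exists q : set (pformula M X),
    [/\ complete_type C q, p `<=` q & strictly_nondividing A C q].

(* Formulas phi(x, y) over A are of the form phi(x, y, d) with d in A. *)
Definition heir (L : language) (M : structure L) (X : ctx L)
    (A B : set (elt M)) (p : set (pformula M X)) : Prop :=
  forall (Y Z : fctx L) (phi : formula (csum X (fsum Y Z)))
         (d : assign M Z) (c : assign M Y), rng d `<=` A -> rng c `<=` B ->
    p (@Pformula L M X (fsum Y Z) phi (fcat c d)) ->
    exists c' : assign M Y, rng c' `<=` A /\
      p (@Pformula L M X (fsum Y Z) phi (fcat c' d)).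

Definition coheir (L : language) (M : structure L) (X : ctx L)
    (A : set (elt M)) (p : set (pformula M X)) : Prop :=
  finitely_satisfiable_in A p.

(* Main.v *)
(* Everything that has to be moved is finite. If p is strictly free, a
   forking witness over N is moved into the saturated model C over A and the
   finitely many parameters involved, where it divides. Conversely, let a
   realize p and satisfy both conditions. A finite subset K of C can be moved
   into N by an automorphism f of M fixing A and K /\ N; by hypothesis the
   dividing obstructions over f(K) fail at a, hence those over K fail at
   f^-1(a). An ultrafilter on the conjugates f^-1(a), along the finite sets K,
   has the required global type as its limit. If p is an heir, a formula over
   Aa witnessing that tp(N/Aa) divides is satisfied by a tuple of A; such a
   tuple satisfies all the conjugates over A of the formula it implies, which
   are therefore consistent. *)

Require Import Defs.
From mathcomp Require Import all_boot.
From mathcomp Require Import boolp classical_sets functions cardinality filter.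

(* MathComp shadows the name [over] of [Defs]. *)
Import Defs.

Set Implicit Arguments.
Unset Strict Implicit.
Unset Printing Implicit Defensive.

Local Open Scope classical_set_scope.
Local Open Scope card_scope.

(** * Choice and finite enumerations *)

Lemma dep_choice (I : Type) (T : I -> Type) (P : forall i, T i -> Prop) :
  (forall i, exists y, P i y) -> exists f : forall i, T i, forall i, P i (f i).
Proof.
by move=> H; exists (fun i => projT1 (cid (H i))) => i; exact: svalP (cid _).
Qed.

Lemma finite_set_enum (T : Type) (V : set T) : finite_set V ->
  exists (n : nat) (r : 'I_n -> T), injective r /\ V = range r.
Proof.
move=> /(@finite_seqP {classic T})[s ->].
have us := undup_uniq s; exists (size (undup s)), (tnth (in_tuple (undup s))).
split=> [i j|]; first by move=> /(tuple_uniqP (in_tuple (undup s)) us).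
apply/seteqP; split=> [x|_ [i _ <-]].
  by rewrite /= -mem_undup => /(tnthP (in_tuple (undup s)))[i ->]; exists i.
by rewrite /= -mem_undup; exact: (mem_tnth i (in_tuple (undup s))).
Qed.

(** * Substitution and finite support *)

Fixpoint tsubst (L : language) (G H : ctx L)
    (u : forall v : G, term H (vsort v)) (s : lsort L) (t : term G s) :
    term H s :=
  match t with
  | Var v => u v
  | App f ts => App (fun i => tsubst u (ts i))
  end.

Definition subst_lift (L : language) (G H : ctx L)
    (u : forall v : G, term H (vsort v)) (s : lsort L) :
    forall v : cext G s, term (cext H s) (vsort v) :=
  fun v => match v with
  | Some x => tsubst (fun y : H => @Var L (cext H s) (Some y)) (u x)
  | None => @Var L (cext H s) None
  end.

Fixpoint fsubst (L : language) (G : ctx L) (phi : formula G) :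
    forall H : ctx L, (forall v : G, term H (vsort v)) -> formula H :=
  match phi with
  | Eq s t t' => fun H u => Eq (tsubst u t) (tsubst u t')
  | Rel r ts => fun H u => Rel (fun i => tsubst u (ts i))
  | Bot => fun H u => Bot H
  | Imp phi psi => fun H u => Imp (fsubst phi u) (fsubst psi u)
  | All s phi => fun H u => All (fsubst phi (subst_lift u (s := s)))
  end.

Section Syntax.
Variables (L : language) (M : structure L).

Definition ev_subst (G H : ctx L) (u : forall v : G, term H (vsort v))
  (a : assign M H) : assign M G := fun v => eval a (u v).

Lemma eval_subst (G H : ctx L) (u : forall v : G, term H (vsort v))
    (a : assign M H) (s : lsort L) (t : term G s) :
  eval a (tsubst u t) = eval (ev_subst u a) t.
Proof. by elim: t => //= f ts IH; congr funI; apply: functional_extensionality_dep => i. Qed.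

Lemma sat_subst (G : ctx L) (phi : formula G) (H : ctx L)
    (u : forall v : G, term H (vsort v)) (a : assign M H) :
  sat (fsubst phi u) a <-> sat phi (ev_subst u a).
Proof.
elim: phi H u a => [G' s t t'|G' r ts|G'|G' p IHp q IHq|G' s p IHp] H u a //=.
- by rewrite !eval_subst.
- suff -> : (fun i => eval a (tsubst u (ts i))) =
    fun i => eval (ev_subst u a) (ts i) by [].
  by apply: functional_extensionality_dep => i; rewrite eval_subst.
- by rewrite IHp IHq.
suff E m : ev_subst (subst_lift u (s := s)) (tpush a m) = tpush (ev_subst u a) m.
  by split=> h m; move: (h m); rewrite IHp E.
by apply: functional_extensionality_dep => -[x|] //=; rewrite /ev_subst /= eval_subst.
Qed.

Definition sub_ctx (G : ctx L) (V : set G) : ctx L :=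
  Ctx (fun v : {x : G | V x} => vsort (sval v)).

Definition res (G : ctx L) (V : set G) (a : assign M G) :
  assign M (sub_ctx V) := fun v => a (sval v).
Arguments res {G} V a v.

Definition res_incl (G : ctx L) (V W : set G) (VW : V `<=` W) :
    forall v : sub_ctx V, term (sub_ctx W) (vsort v) :=
  fun v => @Var L (sub_ctx W) (exist W (sval v) (VW _ (svalP v))).

Lemma term_support (G : ctx L) (s : lsort L) (t : term G s) :
  exists (V : set G), finite_set V /\ exists t' : term (sub_ctx V) s,
    forall a : assign M G, eval a t = eval (res V a) t'.
Proof.
elim: t => [v|f ts /choice[V /all_and2[finV]]].
  exists [set v]; split; first exact: finite_set1.
  by exists (@Var L (sub_ctx [set v]) (exist [set v] v erefl)).
move=> /dep_choice[t' E]; exists (\bigcup_(i in [set: 'I_(farity f)]) V i).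
split; first by apply: bigcup_finite => // i _; exact: finV.
have sV i : V i `<=` \bigcup_(i in [set: 'I_(farity f)]) V i by exact: bigcup_sup.
exists (App (fun i => tsubst (res_incl (sV i)) (t' i))) => a /=.
congr funI; apply: functional_extensionality_dep => i.
by rewrite E eval_subst.
Qed.

(** A context may be infinite, but a formula mentions only finitely many variables. This is what
    lets formulas about a whole set, read as an infinite tuple, be rewritten with a finite tuple of
    parameters. *)
Lemma formula_support (G : ctx L) (phi : formula G) :
  exists (V : set G), finite_set V /\ exists phi' : formula (sub_ctx V),
    forall a : assign M G, sat phi a <-> sat phi' (res V a).
Proof.
elim: phi => {G} [G s t u|G r ts|G|G p [V [fV [p' Ep]]] q [W [fW [q' Eq']]]|].
- have [V [fV [t' Et]]] := term_support t; have [W [fW [u' Eu]]] := term_support u.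
  exists (V `|` W); split; first by rewrite finite_setU.
  exists (Eq (tsubst (res_incl (@subsetUl _ V W)) t')
             (tsubst (res_incl (@subsetUr _ V W)) u')) => a /=.
  by rewrite !eval_subst Et Eu.
- have /choice[V /all_and2[finV /dep_choice[t' E]]] := fun i => term_support (ts i).
  exists (\bigcup_(i in [set: 'I_(rarity r)]) V i).
  split; first by apply: bigcup_finite => // i _; exact: finV.
  have sV i : V i `<=` \bigcup_(i in [set: 'I_(rarity r)]) V i by exact: bigcup_sup.
  exists (Rel (fun i => tsubst (res_incl (sV i)) (t' i))) => a /=.
  suff -> : (fun i => eval a (ts i)) =
    fun i => eval (res (\bigcup_(i in setT) V i) a) (tsubst (res_incl (sV i)) (t' i)) by [].
  by apply: functional_extensionality_dep => i; rewrite eval_subst E.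
- by exists set0; split; [exact: finite_set0|exists (Bot _)].
- exists (V `|` W); split; first by rewrite finite_setU.
  exists (Imp (fsubst p' (res_incl (@subsetUl _ V W)))
              (fsubst q' (res_incl (@subsetUr _ V W)))) => a /=.
  by rewrite !sat_subst Ep Eq'.
move=> G s p [V [fV [p' E]]].
pose W : set G := Some @^-1` V; exists W; split.
  by apply: finite_preimage => // x y _ _ [].
(* The bound variable [None] need not be in [V]; if it is, it becomes the variable quantified in the
   new formula. *)
have /dep_choice[u Eu] : forall v : sub_ctx V,
    exists u : term (cext (sub_ctx W) s) (vsort v),
    forall (a : assign M G) m, eval (tpush (res W a) m) u = tpush a m (sval v).
  case=> -[x|] Vx; last by exists (@Var L (cext (sub_ctx W) s) None).
  by exists (@Var L (cext (sub_ctx W) s) (Some (exist W x Vx))).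
exists (All (fsubst p' u)) => a /=.
suff Es m : sat p (tpush a m) <-> sat (fsubst p' u) (tpush (res W a) m).
  by split=> h m; apply/Es.
rewrite sat_subst E; suff -> : res V (tpush a m) = ev_subst u (tpush (res W a) m) by [].
by apply: functional_extensionality_dep => v; rewrite /ev_subst Eu.
Qed.

Lemma sat_support (G : ctx L) (phi : formula G) :
  exists V : set G, finite_set V /\ forall a b : assign M G,
    (forall v, V v -> a v = b v) -> sat phi a -> sat phi b.
Proof.
have [V [fV [phi' E]]] := formula_support phi; exists V; split=> // a b ab.
rewrite !E; suff -> : res V a = res V b by [].
by apply: functional_extensionality_dep => -[v Vv]; exact: ab.
Qed.

Definition reindex_ctx (G : ctx L) (n : nat) (r : 'I_n -> G) : fctx L :=
  Fctx (fun i => vsort (r i)).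

(** Only the variables of [G] are cut down. The list [r] has no repetition, so a tuple indexed by it
    can be extended to one indexed by [G]. *)
Lemma formula_fin_support (X G : ctx L) (phi : formula (csum X G)) :
  exists (n : nat) (r : 'I_n -> G), injective r /\
    exists phi' : formula (csum X (reindex_ctx r)),
    forall (x : assign M X) (g : assign M G),
      sat phi (tcat x g) <->
      sat phi' (@tcat L M X (reindex_ctx r) x (fun i => g (r i))).
Proof.
have [V [fV [phi' E]]] := formula_support phi.
pose W : set G := inr @^-1` V; have fW : finite_set W.
  by apply: finite_preimage => // x y _ _ [].
have [n [r [rI Wr]]] := finite_set_enum fW; exists n, r; split=> //.
have /dep_choice[u Eu] : forall v : sub_ctx V,
    exists u : term (csum X (reindex_ctx r)) (vsort v),
    forall (x : assign M X) (g : assign M G),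
    eval (@tcat L M X (reindex_ctx r) x (fun i => g (r i))) u = tcat x g (sval v).
  case=> -[x|y] Vx; first by exists (@Var L (csum X (reindex_ctx r)) (inl x)).
  have : W y := Vx; rewrite Wr => -[i _ riy]; case: y / riy Vx => Vx.
  by exists (@Var L (csum X (reindex_ctx r)) (inr i)).
exists (fsubst phi' u) => x g; rewrite sat_subst E.
suff -> : res V (tcat x g) =
  ev_subst u (@tcat L M X (reindex_ctx r) x (fun i => g (r i))) by [].
by apply: functional_extensionality_dep => v; rewrite /ev_subst Eu.
Qed.

Lemma formula_conj (G : ctx L) (d : nat) (phi : 'I_d -> formula G) :
  exists chi : formula G, forall a : assign M G,
    sat chi a <-> forall l, sat (phi l) a.
Proof.
elim: d phi => [|d IH] phi; first by exists (Neg (Bot G)) => a; split=> // _ [].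
have [chi E] := IH (fun l => phi (lift ord0 l)).
exists (Neg (Imp (phi ord0) (Neg chi))) => a /=; rewrite E; split=> [h l|h].
  case: (unliftP ord0 l) => [j|] ->; apply: contrapT => nh; apply: h.
    by move=> _ hj; exact/nh/hj.
  by move=> /nh.
by move=> /(_ (h _)); apply=> l; exact: h.
Qed.

Lemma pformula_of_params (X G : ctx L) (chi : formula (csum X G))
    (g : assign M G) :
  exists phi : pformula M X, rng (@ppar _ _ _ phi) `<=` rng g /\
    forall x, holds phi x <-> sat chi (tcat x g).
Proof.
have [n [r [_ [chi' E]]]] := formula_fin_support chi.
exists (@Pformula L M X (reindex_ctx r) chi' (fun i => g (r i))).
by split=> [_ [i ->]|x]; [exists (r i)|rewrite E].
Qed.

End Syntax.

Lemma sval_injective (T : Type) (P : set T) :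
  injective (@proj1_sig T P).
Proof. by move=> [x Px] [y Py] /= xy; exact: eq_exist. Qed.

(** * Small sets *)

Lemma injective_card_le (T U : Type) (A : set T) (B : set U) (f : T -> U) :
  (forall x, A x -> B (f x)) -> {in A &, injective f} -> A #<= B.
Proof.
move=> fAB fI; apply: (@card_le_trans _ _ _ (f @` A)).
  by move: (inj_card_eq fI); rewrite card_eq_le => /andP[].
by apply: subset_card_le => _ [x /fAB Bfx <-].
Qed.

Lemma card_le_lt_trans (T U V : Type) (A : set T) (B : set U) (K : set V) :
  A #<= B -> card_lt B K -> card_lt A K.
Proof.
move=> AB [BK nKB]; split; first exact: card_le_trans AB BK.
by move=> KA; apply: nKB; apply: card_le_trans KA AB.
Qed.

(** Hilbert's hotel: along a sequence [j] of distinct elements of [A], every term is shifted by [n]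
    places, and the [n] new elements take the first places. *)
Lemma infinite_add_finite (T : Type) (A : set T) (n : nat) : infinite_set A ->
  [set: {x | A x} + 'I_n] #<= A.
Proof.
move=> /infiniteP/card_leP[f].
pose j (m : nat) : T := set_val (f (SigSub (mem_set (I : [set: nat] m)))).
have jA m : A (j m) by exact: set_valP.
have jI : injective j.
  move=> m m' /val_inj /(@inj _ _ _ f) => /(_ (mem_set I) (mem_set I)).
  by move=> /(congr1 val).
pose h (v : {x | A x} + 'I_n) : T := match v with
  | inl x => if pselect (exists m, sval x = j m) is left e
             then j (sval (cid e) + n)%N else sval x
  | inr i => j i end.
apply: (@injective_card_le _ _ _ _ h) => [[x|i] _|] /=.
- by case: pselect => // _; exact: svalP.
- exact: jA.
have shift (k : nat) (i : 'I_n) : (k + n)%N <> i.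
  by move=> e; move: (ltn_ord i); rewrite -e ltnNge leq_addl.
move=> [x|i] [y|i'] _ _ /=.
- case: pselect => [e|ne]; case: pselect => [e'|ne'] E.
  + move: E => /jI /addIn E; congr inl; apply: sval_injective.
    by rewrite (svalP (cid e)) (svalP (cid e')) E.
  + by case: ne'; rewrite -E; eexists.
  + by case: ne; rewrite E; eexists.
  + by congr inl; exact: sval_injective.
- case: pselect => [e /jI/shift //|ne E].
  by case: ne; exists i'.
- case: pselect => [e /esym/jI/shift //|ne E].
  by case: ne; exists i.
- by move=> /jI/ord_inj ->.
Qed.

(** An infinite [A] absorbs the new elements; a finite one leaves the sum finite, hence smaller than
    the infinite [K]. *)
Lemma small_add_finite (T K : Type) (A : set T) (n : nat) :
  [set: nat] #<= [set: K] -> card_lt A [set: K] ->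
  card_lt [set: {x | A x} + 'I_n] [set: K].
Proof.
move=> natK AK; have [finA|infA] := pselect (finite_set A); last first.
  exact: card_le_lt_trans (infinite_add_finite n infA) AK.
have fin : finite_set [set: {x | A x} + 'I_n].
  suff -> : [set: {x | A x} + 'I_n] = inl @` setT `|` inr @` setT.
    rewrite finite_setU; split; apply: finite_image => //.
    apply: card_le_finite finA.
    apply: (@injective_card_le _ _ _ _ sval) => [x _|x y _ _]; first exact: svalP.
    exact: sval_injective.
  by apply/seteqP; split=> // -[x|i] _; [left; exists x|right; exists i].
have infK : infinite_set [set: K] by apply/infiniteP.
split; last by move=> /card_le_finite /(_ fin).
have [m] := fin; rewrite card_eq_le => /andP[le _].
by apply: card_le_trans le _; apply: card_le_trans natK; exact: card_leT.
Qed.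

Lemma card_le_sig (T : Type) (B : set T) : B #<= [set: {x | B x}].
Proof.
apply: card_le_trans (card_image_le (@proj1_sig T B) setT).
by apply: subset_card_le => x Bx; exists (exist _ x Bx).
Qed.

Lemma card_le_add_rng (L : language) (M : structure L) (F : fctx L)
    (A : set (elt M)) (c : assign M F) :
  A `|` rng c #<= [set: {x | A x} + 'I_(fsize F)].
Proof.
have /dep_choice[h H] : forall x : {x | (A `|` rng c) x},
    exists v : {x | A x} + 'I_(fsize F), match v with
    | inl y => sval y = sval x
    | inr i => existT _ (fsort i) (c i) = sval x end.
  by case=> x [Ax|[i E]]; [exists (inl (exist _ x Ax))|exists (inr i)].
have hI : injective h.
  move=> x y hxy; apply: sval_injective; have := H x; have := H y; rewrite hxy.
  by case: (h y) => ? <- <-.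
have le : [set: {x | (A `|` rng c) x}] #<= [set: {x | A x} + 'I_(fsize F)].
  by apply: (@injective_card_le _ _ _ _ h) => // x y _ _ /hI.
exact: card_le_trans (card_le_sig _) le.
Qed.

(** * Automorphisms *)

Section Automorphisms.
Variables (L : language) (M : structure L).

Definition automorphism (f : forall s, M s -> M s) : Prop :=
  (forall (G : ctx L) (phi : formula G) (a : assign M G),
     sat phi a <-> sat phi (tmap f a)) /\
  exists g : forall s, M s -> M s,
    (forall s, cancel (f s) (g s)) /\ (forall s, cancel (g s) (f s)).

Definition fixes (S : set (elt M)) (f : forall s, M s -> M s) : Prop :=
  forall x, S x -> f _ (projT2 x) = projT2 x.

Lemma fixes_sub (S S' : set (elt M)) (f : forall s, M s -> M s) :
  S `<=` S' -> fixes S' f -> fixes S f.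
Proof. by move=> SS' fS' x /SS'; exact: fS'. Qed.

Lemma tmap_fixes (S : set (elt M)) (f : forall s, M s -> M s) (G : ctx L)
    (a : assign M G) : fixes S f -> rng a `<=` S -> tmap f a = a.
Proof.
move=> fS aS; apply: functional_extensionality_dep => v.
by apply: (fS (existT _ _ (a v))); apply: aS; exists v.
Qed.

Lemma tmap_tcat (f : forall s, M s -> M s) (G H : ctx L) (a : assign M G)
    (b : assign M H) : tmap f (tcat a b) = tcat (tmap f a) (tmap f b).
Proof. by apply: functional_extensionality_dep => -[]. Qed.

Lemma tmap_cancel (f g : forall s, M s -> M s) (G : ctx L) (a : assign M G) :
  (forall s, cancel (f s) (g s)) -> tmap g (tmap f a) = a.
Proof. by move=> fg; apply: functional_extensionality_dep => v; exact: fg. Qed.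

Lemma rng_subP (G : ctx L) (a : assign M G) (S : set (elt M)) :
  rng a `<=` S <-> forall v, S (existT _ (vsort v) (a v)).
Proof. by split=> [h v|h _ [v ->]]; [apply: h; exists v|]. Qed.

Lemma rng_set_tuple (B : set (elt M)) : rng (set_tuple (B := B)) = B.
Proof.
apply/seteqP; split=> [_ [b ->]|[s x] Bx]; first by case: b => -[s x] Bx.
by exists (exist _ (existT _ s x) Bx).
Qed.

Lemma finite_rng (F : fctx L) (c : assign M F) : finite_set (rng c).
Proof.
rewrite (_ : rng c = (fun i => existT _ _ (c i)) @` [set: 'I_(fsize F)]).
  exact/finite_image/finite_finset.
by apply/seteqP; split=> [_ [i ->]|_ [i _ <-]]; exists i.
Qed.

Lemma finite_set_tuple (K : set (elt M)) : finite_set K ->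
  exists (F : fctx L) (c : assign M F), rng c = K.
Proof.
move=> /finite_set_enum[n [r [_ ->]]].
exists (Fctx (fun i => projT1 (r i))), (fun i => projT2 (r i)).
apply/seteqP; split=> [_ [i ->]|_ [i _ <-]]; exists i => //=; by case: (r i).
Qed.

(** [automorphism_of] tests finite contexts only, and finite support extends this to all contexts.
    Surjectivity gives a right inverse; it is two-sided because [f] preserves and reflects
    equality. *)
Lemma automorphism_ofT (f : forall s, M s -> M s) :
  automorphism_of [set: elt M] f -> automorphism f.
Proof.
move=> [fsat fsurj].
have fsat' (G : ctx L) (phi : formula G) (a : assign M G) :
    sat phi a <-> sat phi (tmap f a).
  (* The empty context plays the object variables, so that finite support applies to all the
     variables of [phi]. *)
  pose phi0 := fsubst phi (fun v => @Var L (csum (cempty L) G) (inr v)).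
  have E (b : assign M G) : sat phi b <-> sat phi0 (tcat (tempty M) b) by rewrite sat_subst.
  have [n [r [_ [phi1 E1]]]] := formula_fin_support M phi0.
  pose phi2 := fsubst phi1 (H := reindex_ctx r) (fun v => match v with
    | inl x => match x with end
    | inr y => @Var L (reindex_ctx r) y end).
  have E2 (b : assign M G) : sat phi b <-> sat phi2 (fun i => b (r i)).
    rewrite E E1 sat_subst; set b1 := tcat _ _; set b2 := ev_subst _ _.
    suff -> : b1 = b2 by [].
    by apply: functional_extensionality_dep => -[[]|].
  by rewrite !E2; exact: fsat.
split=> //.
have /dep_choice[g fg] : forall s, exists g : M s -> M s, cancel g (f s).
  move=> s; suff /choice[g fg] : forall y : M s, exists x, f s x = y by exists g.
  move=> y; have : [set: elt M] (existT _ s y) by [].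
  rewrite -fsurj => -[x _ xy].
  suff H : forall z : elt M, (exists x : elt M,
      existT _ (projT1 x) (f _ (projT2 x)) = z) -> exists x, f _ x = projT2 z.
    by apply: (H (existT _ s y)); exists x.
  by move=> _ [[s' x'] <-]; exists x'.
exists g; split=> // s x.
pose phi := Eq (@Var L (Ctx (fun _ : bool => s)) true)
  (@Var L (Ctx (fun _ : bool => s)) false).
have /(_ (fun b : bool => if b then g s (f s x) else x)) := fsat' _ phi.
by move=> /= ->; rewrite /tmap fg.
Qed.

End Automorphisms.

(** * Types and dividing *)

Section Dividing.
Variables (L : language) (M : structure L).

Definition pmove (f : forall s, M s -> M s) (X : ctx L) (phi : pformula M X) :
  pformula M X := Pformula (pbody phi) (tmap f (@ppar _ _ _ phi)).

(** The parameter tuple is left alone, so a sequence witnessing dividing can be reused unchanged. *)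
Definition psubst (X Y : ctx L) (u : forall v : X, term Y (vsort v))
    (phi : pformula M X) : pformula M Y :=
  @Pformula L M Y (pctx phi)
    (fsubst (H := csum Y (pctx phi)) (pbody phi) (fun v => match v with
       | inl x => tsubst (fun y : Y => @Var L (csum Y (pctx phi)) (inl y)) (u x)
       | inr z => @Var L (csum Y (pctx phi)) (inr z) end))
    (@ppar _ _ _ phi).

Lemma sat_psubst (X Y : ctx L) (u : forall v : X, term Y (vsort v))
    (phi : pformula M X) (y : assign M Y) (b : assign M (pctx phi)) :
  sat (pbody (psubst u phi)) (tcat y b) <-> sat (pbody phi) (tcat (ev_subst u y) b).
Proof.
rewrite sat_subst; set a1 := ev_subst _ _; set a2 := tcat (ev_subst _ _) _.
suff -> : a1 = a2 by [].
apply: functional_extensionality_dep => -[x|z] //.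
by rewrite /a1 /ev_subst eval_subst.
Qed.

Lemma holds_pmove (f : forall s, M s -> M s) (X : ctx L) (phi : pformula M X)
    (x : assign M X) :
  automorphism f -> holds (pmove f phi) (tmap f x) <-> holds phi x.
Proof. by move=> [fsat _]; rewrite /holds -tmap_tcat -fsat. Qed.

Lemma pmove_fixes (f : forall s, M s -> M s) (X : ctx L) (phi : pformula M X)
    (S : set (elt M)) : fixes S f -> over S phi -> pmove f phi = phi.
Proof. by move=> fS oS; rewrite /pmove (tmap_fixes fS oS); case: phi oS. Qed.

Lemma complete_tp (X : ctx L) (a : assign M X) (B : set (elt M)) :
  complete_type B (tp a B).
Proof.
split=> [phi []//|d phi phia|phi oB].
  by exists a; split=> // l; case: (phia l).
by have [h|h] := pselect (holds phi a); [left|right].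
Qed.

Lemma realizes_tpE (X : ctx L) (a : assign M X) (B : set (elt M))
    (p : set (pformula M X)) : complete_type B p -> realizes a p -> tp a B = p.
Proof.
move=> [pB _ pc] ap; apply/seteqP; split=> [phi [oB ha]|phi pphi]; last first.
  by split; [exact: pB|exact: ap].
by have [//|/ap /(_ ha)] := pc _ oB.
Qed.

Lemma realizes_sub (X : ctx L) (a : assign M X) (p q : set (pformula M X)) :
  p `<=` q -> realizes a q -> realizes a p.
Proof. by move=> pq aq phi /pq /aq. Qed.

Lemma tp_tmap (f : forall s, M s -> M s) (X : ctx L) (a : assign M X)
    (A : set (elt M)) : automorphism f -> fixes A f -> tp (tmap f a) A = tp a A.
Proof.
move=> fa fA; apply: realizes_tpE; first exact: complete_tp.
by move=> phi [oA ha]; rewrite -(pmove_fixes fA oA); apply/holds_pmove.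
Qed.

(** The same sequence serves again, since moving the parameters over [A] does not change their type
    over [A]. *)
Lemma formula_divides_pmove (f : forall s, M s -> M s) (X : ctx L)
    (phi : pformula M X) (A : set (elt M)) :
  automorphism f -> fixes A f -> formula_divides A phi ->
  formula_divides A (pmove f phi).
Proof.
move=> fa fA [k [b [bA incons]]]; exists k, b; split=> // i.
by rewrite bA tp_tmap.
Qed.

Lemma formula_divides_psubst (X Y : ctx L) (u : forall v : X, term Y (vsort v))
    (phi : pformula M X) (A : set (elt M)) :
  formula_divides A phi -> formula_divides A (psubst u phi).
Proof.
move=> [k [b [bA incons]]]; exists k, b; split=> // j /incons nsat [y ysat].
by apply: nsat; exists (ev_subst u y) => l; apply/sat_psubst/ysat.
Qed.

(* A dividing tuple [B] over [A] stays dividing after an automorphism over [A]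
   and after replacing the entries irrelevant to the [psi l] arbitrarily. *)
Lemma divides_transfer (A B B' E : set (elt M)) (g : forall s, M s -> M s)
    (phi : pformula M (set_ctx B)) (d : nat)
    (psi : 'I_d -> pformula M (set_ctx B)) (h : assign M (set_ctx B)) :
  automorphism g -> fixes A g -> formula_divides A phi ->
  (forall y, (forall l, holds (psi l) y) -> holds phi y) ->
  rng h `<=` B' ->
  (forall l, over E (pmove g (psi l)) /\ holds (pmove g (psi l)) h) ->
  divides A (tp (set_tuple (B := B')) E).
Proof.
move=> ga gA phiA psiphi /rng_subP hB' psih.
(* The entry [h v] lies in [B'], so it is named by a variable there; under [u] the tuple enumerating
   [B'] is read as [h]. *)
pose u (v : set_ctx B) : term (set_ctx B') (vsort v) :=
  @Var L (set_ctx B') (exist B' (existT _ (vsort v) (h v)) (hB' v)).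
exists (psubst u (pmove g phi)); split.
  exact/formula_divides_psubst/formula_divides_pmove.
exists d, (fun l => psubst u (pmove g (psi l))); split=> [l|y yl].
  have [oE hh] := psih l; split; first exact: oE.
  by apply/sat_psubst; exact: hh.
have [_ [g' [gg' g'g]]] := ga.
apply/sat_psubst; rewrite -[ev_subst u y](tmap_cancel _ g'g).
apply/(holds_pmove _ _ ga)/psiphi => l; apply/(holds_pmove _ _ ga).
by rewrite (tmap_cancel _ g'g); apply/sat_psubst/yl.
Qed.

(* [e x] is the tuple obtained from the parameters of [psi] by replacing the
   entries coming from [a] by those of [x]. *)
Lemma variable_parameters (X G : ctx L) (A : set (elt M)) (a : assign M X)
    (psi : pformula M G) : over (A `|` rng a) psi ->
  exists (e : assign M X -> assign M (pctx psi))
         (chi : formula (csum (csum X (set_ctx A)) G)),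
  [/\ e a = @ppar _ _ _ psi, forall x, rng (e x) `<=` A `|` rng x,
      forall f x, fixes A f -> tmap f (e x) = e (tmap f x)
    & forall x y, sat chi (tcat (tcat x (set_tuple (B := A))) y) <->
                  sat (pbody psi) (tcat y (e x))].
Proof.
move=> opsi; pose At := set_tuple (B := A).
have term_of (z : elt M) : (A `|` rng a) z ->
    exists t : term (csum X (set_ctx A)) (projT1 z),
    [/\ eval (tcat a At) t = projT2 z,
        forall x, (A `|` rng x) (existT _ _ (eval (tcat x At) t))
      & forall f x, fixes A f ->
          f _ (eval (tcat x At) t) = eval (tcat (tmap f x) At) t].
  move=> [Az|[v ->]].
    exists (@Var L (csum X (set_ctx A)) (inr (exist A z Az))).
    split=> //=; first by move=> x; left; case: z Az.
    by move=> f x; apply.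
  by exists (@Var L (csum X (set_ctx A)) (inl v)); split=> //= x; right; exists v.
have /dep_choice[t Ht] : forall i : pctx psi,
    exists t : term (csum X (set_ctx A)) (vsort i),
    [/\ eval (tcat a At) t = @ppar _ _ _ psi i,
        forall x, (A `|` rng x) (existT _ _ (eval (tcat x At) t))
      & forall f x, fixes A f ->
          f _ (eval (tcat x At) t) = eval (tcat (tmap f x) At) t].
  by move=> i; apply: (term_of (existT _ _ (@ppar _ _ _ psi i))); apply: opsi; exists i.
pose H := csum (csum X (set_ctx A)) G.
exists (fun x i => eval (tcat x At) (t i)), (fsubst (H := H) (pbody psi)
  (fun v => match v with
     | inl y => @Var L H (inr y)
     | inr i => tsubst (fun w => @Var L H (inl w)) (t i) end)); split.
- by apply: functional_extensionality_dep => i; have [] := Ht i.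
- by move=> x; apply/rng_subP => i; have [_ + _] := Ht i; apply.
- move=> f x fA; apply: functional_extensionality_dep => i.
  by have [_ _ +] := Ht i; apply.
move=> x y; rewrite sat_subst; set a1 := ev_subst _ _; set a2 := tcat _ _.
suff -> : a1 = a2 by [].
apply: functional_extensionality_dep => -[v|i] //.
by rewrite /a1 /ev_subst eval_subst.
Qed.

(** * Regrouping the variables of a formula *)

Lemma csum_assoc (X G H : ctx L) (chi : formula (csum (csum X G) H)) :
  exists chi' : formula (csum X (csum G H)), forall x (g : assign M G) h,
    sat chi' (tcat x (tcat g h)) <-> sat chi (tcat (tcat x g) h).
Proof.
pose K := csum X (csum G H).
exists (fsubst chi (fun v => match v with
  | inl (inl x) => @Var L K (inl x)
  | inl (inr y) => @Var L K (inr (inl y))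
  | inr z => @Var L K (inr (inr z)) end)) => x g h.
rewrite sat_subst; set a1 := ev_subst _ _; set a2 := tcat _ _.
suff -> : a1 = a2 by [].
by apply: functional_extensionality_dep => -[[]|].
Qed.

Lemma csum_swap (X Y : ctx L) (chi : formula (csum X Y)) :
  exists chi' : formula (csum Y X), forall (x : assign M X) (y : assign M Y),
    sat chi' (tcat y x) <-> sat chi (tcat x y).
Proof.
exists (fsubst chi (fun v => match v with
  | inl x => @Var L (csum Y X) (inr x)
  | inr y => @Var L (csum Y X) (inl y) end)) => x y.
rewrite sat_subst; set a1 := ev_subst _ _; set a2 := tcat _ _.
suff -> : a1 = a2 by [].
by apply: functional_extensionality_dep => -[].
Qed.

Lemma csum_swapr (X Y Z : ctx L) (chi : formula (csum (csum X Y) Z)) :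
  exists chi' : formula (csum (csum X Z) Y),
    forall (x : assign M X) (y : assign M Y) (z : assign M Z),
    sat chi' (tcat (tcat x z) y) <-> sat chi (tcat (tcat x y) z).
Proof.
pose K := csum (csum X Z) Y.
exists (fsubst chi (fun v => match v with
  | inl (inl x) => @Var L K (inl (inl x))
  | inl (inr y) => @Var L K (inr y)
  | inr z => @Var L K (inl (inr z)) end)) => x y z.
rewrite sat_subst; set a1 := ev_subst _ _; set a2 := tcat _ _.
suff -> : a1 = a2 by [].
by apply: functional_extensionality_dep => -[[]|].
Qed.

Lemma csum_fsum (X : ctx L) (Y Z : fctx L) (chi : formula (csum (csum X Y) Z)) :
  exists chi' : formula (csum X (fsum Y Z)),
    forall (x : assign M X) (y : assign M Y) (z : assign M Z),
    sat chi' (@tcat L M X (fsum Y Z) x (fcat y z)) <-> sat chi (tcat (tcat x y) z).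
Proof.
pose K := csum X (fsum Y Z).
(* Writing [w] as the split of an index of the concatenation makes the sorts and values agree by
   computation. *)
have var_of (w : 'I_(fsize Y) + 'I_(fsize Z)) : exists t : term K
      (match w with inl i => fsort i | inr i => fsort i end),
    forall (x : assign M X) (y : assign M Y) (z : assign M Z),
    eval (@tcat L M X (fsum Y Z) x (fcat y z)) t =
    match w return M (match w with inl i => fsort i | inr i => fsort i end) with
    | inl i => y i | inr i => z i end.
  rewrite -(unsplitK w); move: (unsplit w) => i.
  by exists (@Var L K (inr i)).
have /dep_choice[u Eu] : forall v : csum (csum X Y) Z, exists t : term K (vsort v),
    forall (x : assign M X) (y : assign M Y) (z : assign M Z),
    eval (@tcat L M X (fsum Y Z) x (fcat y z)) t = tcat (tcat x y) z v.
  case=> [[x|y]|z]; first by exists (@Var L K (inl x)).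
    exact: (var_of (inl y)).
  exact: (var_of (inr z)).
exists (fsubst chi u) => x y z; rewrite sat_subst.
set a1 := ev_subst _ _; set a2 := tcat _ _; suff -> : a1 = a2 by [].
by apply: functional_extensionality_dep => v; rewrite /a1 /ev_subst Eu.
Qed.

Lemma rng_fcat (Y Z : fctx L) (y : assign M Y) (z : assign M Z)
    (B : set (elt M)) :
  rng y `<=` B -> rng z `<=` B -> rng (fcat y z : assign M (fsum Y Z)) `<=` B.
Proof.
move=> /rng_subP yB /rng_subP zB; apply/rng_subP => i /=.
by rewrite /fcat; case: (fintype.split i) => j; [exact: yB|exact: zB].
Qed.

(** A finite part of [p] has a solution [a] in [A], which satisfies some [phi l]. Being in [A], it
    then satisfies all the conjugates of [phi l] over [A], against their inconsistency. *)
Lemma coheir_nonforking (X : fctx L) (A : set (elt M)) (p : set (pformula M X)) :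
  coheir A p -> ~ forks A p.
Proof.
move=> pA [d [phi [phiA [d' [psi [psip psiphi]]]]]].
have [a [aA psia]] := pA _ _ psip; have [l phia] := psiphi _ psia.
have [k [b [bA]]] := phiA l; move=> /(_ (@nat_of_ord k) (@ord_inj k)); apply.
have [chi chiE] := csum_swap (pbody (phi l)).
exists a => i; apply/chiE.
suff [_] : tp (b i) A (@Pformula L M (pctx (phi l)) X chi a) by [].
by rewrite bA; split=> //; apply/chiE.
Qed.

Lemma divides_forks (X : ctx L) (A : set (elt M)) (p : set (pformula M X)) :
  divides A p -> forks A p.
Proof.
move=> [phi [phiA [d [psi [ppsi psiphi]]]]].
exists 1%N, (fun=> phi); split=> //; exists d, psi; split=> // x xpsi.
by exists ord0; exact: psiphi.
Qed.

Lemma divides_of_mem (X : ctx L) (A : set (elt M)) (p : set (pformula M X))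
    (phi : pformula M X) : formula_divides A phi -> p phi -> divides A p.
Proof.
move=> phiA pphi; exists phi; split=> //.
by exists 1%N, (fun=> phi); split=> // x /(_ ord0).
Qed.

(** Strong homogeneity concerns types over the empty set, so the parameters in [S] are made entries
    of the tuple. *)
Lemma tp_set0_tcat (S : set (elt M)) (F : ctx L) (b b' : assign M F) :
  realizes b' (tp b S) ->
  tp (tcat (set_tuple (B := S)) b) set0 `<=` tp (tcat (set_tuple (B := S)) b') set0.
Proof.
move=> bb' phi [phi0 phib]; split=> //.
pose G := csum F (set_ctx S).
(* As [phi] is over the empty set, it has no parameter variables and the last case is vacuous. *)
pose u : forall v : csum (csum (set_ctx S) F) (pctx phi), term G (vsort v) :=
  fun v => match v with
    | inl (inl x) => @Var L G (inr x)
    | inl (inr y) => @Var L G (inl y)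
    | inr i => False_rect _ (phi0 _ (ex_intro _ i erefl)) end.
have [chi [chiS Echi]] := pformula_of_params (fsubst (pbody phi) u) (set_tuple (B := S)).
have E c : holds chi c <-> holds phi (tcat (set_tuple (B := S)) c).
  rewrite Echi sat_subst /holds; set a1 := ev_subst _ _; set a2 := tcat _ _.
  suff -> : a1 = a2 by [].
  apply: functional_extensionality_dep => -[[x|y]|i] //.
  by have [] : False := phi0 _ (ex_intro _ i erefl).
by apply/E/bb'; split; [rewrite -[S in over S]rng_set_tuple|apply/E].
Qed.

Lemma nat_le_of_theory_card (K : Type) :
  card_lt [set: theory_card L] [set: K] -> [set: nat] #<= [set: K].
Proof.
move=> [LK _]; apply: card_le_trans LK.
by apply: (@injective_card_le _ _ _ _ inr) => // x y _ _ [].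
Qed.

Variable kappa : Type.
Hypothesis M_monster : monster [set: elt M] kappa.

(** This is strong homogeneity for the tuple formed by [S] and [c]; the converse inclusion of types
    comes from negating formulas. *)
Lemma automorphism_extending (S : set (elt M)) (F : fctx L) (c c' : assign M F) :
  card_lt S [set: kappa] -> realizes c' (tp c S) ->
  exists f, [/\ automorphism f, fixes S f & tmap f c = c'].
Proof.
move=> Ssmall cc'; have [_ Lk _ hom] := M_monster.
have c'c : realizes c (tp c' S).
  move=> phi [oS phic']; apply: contrapT => nphi.
  have /cc' /(_ phic') [] : tp c S (pneg phi) by split.
have [|//|//||f [/automorphism_ofT fa fE]] := hom (csum (set_ctx S) F)
    (tcat (set_tuple (B := S)) c) (tcat (set_tuple (B := S)) c').
- exact: small_add_finite (nat_le_of_theory_card Lk) Ssmall.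
- by apply/seteqP; split; exact: tp_set0_tcat.
exists f; split=> //; first by move=> x Sx; exact: (fE (inl (exist S x Sx))).
by apply: functional_extensionality_dep => v; exact: (fE (inr v)).
Qed.

(** The type over [S] of an enumeration of [K] is realized in [D], and an automorphism over [S]
    takes the enumeration to this realization. *)
Lemma move_into (D S K : set (elt M)) :
  card_lt S [set: kappa] -> realizes_types_over D S -> finite_set K ->
  exists f, [/\ automorphism f, fixes S f &
    forall x, K x -> D (existT _ _ (f _ (projT2 x)))].
Proof.
move=> Ssmall DS /finite_set_tuple[F [c <-]].
have [c' [/rng_subP c'D c'c]] := DS F _ (complete_tp c S).
have [f [fa fS fc]] := automorphism_extending Ssmall c'c.
by exists f; split=> // _ [v ->] /=; have := c'D v; rewrite -fc.
Qed.

End Dividing.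

(** * Strictly free types *)

Section Strict.
Variables (L : language) (M : structure L) (C : set (elt M)) (kappa kappa' : Type).
Hypotheses (C_monster : monster C kappa) (M_monster : monster [set: elt M] kappa').
Hypothesis C_small : card_lt C [set: kappa'].
Variable A : set (elt M).
Hypotheses (A_sub_C : A `<=` C) (A_small : card_lt A [set: kappa]).
Variable N : set (elt M).
Hypotheses (A_sub_N : A `<=` N) (N_sub_C : N `<=` C).
Hypothesis N_model : elementary_sub N.
Hypothesis N_saturated : succ_saturated N ({x | A x} + theory_card L)%type.

Lemma small_of_sub (S : set (elt M)) : S `<=` C -> card_lt S [set: kappa'].
Proof. by move=> SC; apply: card_le_lt_trans C_small; exact: subset_card_le. Qed.

Lemma monster_realizes (K : set (elt M)) : finite_set K -> K `<=` C ->
  realizes_types_over C (A `|` K).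
Proof.
move=> /finite_set_tuple[F [c <-]] cC; have [_ Lk sat _] := C_monster.
apply: sat; first by rewrite subUset.
apply: card_le_lt_trans (card_le_add_rng A c) _.
exact: small_add_finite (nat_le_of_theory_card Lk) A_small.
Qed.

Lemma model_realizes (K : set (elt M)) : finite_set K -> K `<=` N ->
  realizes_types_over N (A `|` K).
Proof.
move=> /finite_set_tuple[F [c <-]] cN.
apply: N_saturated; first by rewrite subUset.
apply: card_le_trans (card_le_add_rng A c) _.
(* The finitely many extra parameters go into the summand [nat] of [theory_card L]. *)
apply: (@injective_card_le _ _ _ _ (fun v => match v with
  | inl x => inl x | inr i => inr (inr (nat_of_ord i)) end)) => //.
by move=> [x|i] [y|j] _ _ // => [[->]|[/ord_inj->]].
Qed.

Lemma finite_params (X : ctx L) (d : nat) (phi : 'I_d -> pformula M X) :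
  finite_set (\bigcup_(l in [set: 'I_d]) rng (@ppar _ _ _ (phi l))).
Proof. by apply: bigcup_finite => [|l _]; [exact: finite_finset|exact: finite_rng]. Qed.

(* The parameters of the [phi l] can be moved into [C] over those of the [psi l]. *)
Lemma forks_divides (X : ctx L) (D : set (elt M)) (a : assign M X) : D `<=` C ->
  forks A (tp a D) ->
  exists2 phi, formula_divides A phi & tp a C phi.
Proof.
move=> DC [d [phi [phiA [d' [psi [psia psiphi]]]]]].
set S := \bigcup_(l in [set: 'I_d']) rng (@ppar _ _ _ (psi l)).
have SC : S `<=` C.
  by move=> x [l _ xl]; apply: DC; have [oD _] := psia l; apply: oD.
have ASC : A `|` S `<=` C by rewrite subUset.
have [g [ga gS gC]] := move_into M_monster (small_of_sub ASC)
  (monster_realizes (finite_params psi) SC) (finite_params phi).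
have [_ [g' [gg' g'g]]] := ga.
(* Since [g] fixes the parameters of the [psi l], the preimage of [a] satisfies them too, hence some
   [phi l]. Moved by [g], that formula is over [C] and true of [a]. *)
have [l phil] : exists l, holds (phi l) (tmap g' a).
  apply: psiphi => l; apply/(holds_pmove _ _ ga).
  rewrite (tmap_cancel _ g'g).
  rewrite (pmove_fixes gS); first by have [] := psia l.
  by move=> x xl; right; exists l.
exists (pmove g (phi l)).
  by apply: formula_divides_pmove => //; apply: fixes_sub gS => x; left.
split; last by rewrite -[a](tmap_cancel _ g'g); apply/holds_pmove.
by apply/rng_subP => i; apply: (gC (existT _ _ _)); exists l => //; exists i.
Qed.

Lemma model_inhabited (s : lsort L) : exists x : M s, N (existT _ s x).
Proof.
have [N0 [f [_ ->]]] := N_model; have [n] := carrier_inhabited N0 s.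
by exists (f s n), s, n.
Qed.

(** * Construction of the global type *)

Section Extension.
Variables (X : fctx L) (a : assign M X).
Hypothesis a_nonforking : ~ forks A (tp a N).
Hypothesis N_nondividing : ~ divides A (tp (set_tuple (B := N)) (A `|` rng a)).

(** Fixing the part of [K] in [N] makes the limit type extend the type of [a] over [N]; sending [K]
    into [N] brings formulas over [K] within reach of the hypotheses on [N]. *)
Let conjugates (K : set (elt M)) : set (assign M X) :=
  [set x | exists f, [/\ automorphism f, fixes (A `|` (K `&` N)) f,
     forall z, K z -> N (existT _ _ (f _ (projT2 z))) & tmap f x = a]].

Let conjugates_filter : set_system (assign M X) :=
  filter_from [set K | finite_set K /\ K `<=` C] conjugates.

(** The sets [conjugates K] shrink as [K] grows, so they form a filter base. They are nonempty
    because the saturation of [N] allows [K] to be moved into [N] over [A] and the part of [K] in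
    [N]. *)
Lemma conjugates_proper : ProperFilter conjugates_filter.
Proof.
apply: filter_from_proper.
  apply: filter_from_filter; first by exists set0; split.
  move=> K K' [fK KC] [fK' KC']; exists (K `|` K').
    by split; [rewrite finite_setU|rewrite subUset].
  move=> x [f [fa fS fN fx]]; split; exists f; split=> //.
  - by apply: fixes_sub fS; rewrite setIUl setUA; exact: subsetUl.
  - by move=> z Kz; apply: fN; left.
  - by apply: fixes_sub fS; rewrite setIUl setUCA; exact: subsetUr.
  - by move=> z Kz; apply: fN; right.
move=> K [fK KC].
have KN : K `&` N `<=` N by exact: subIsetr.
have AKC : A `|` (K `&` N) `<=` C.
  by rewrite subUset; split=> //; exact: subset_trans KN N_sub_C.
have [f [fa fS fN]] := move_into M_monster (small_of_sub AKC)
  (model_realizes (sub_finite_set (@subIsetl _ K N) fK) KN) fK.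
have [_ [g [_ gf]]] := fa.
by exists (tmap g a), f; split=> //; exact: tmap_cancel.
Qed.

Lemma strictly_free_of_model : strictly_free C A (tp a N).
Proof.
have [U [uU FU]] := ultraFilterLemma conjugates_proper.
have pU : ProperFilter U by exact: ultra_proper.
(* The limit type: the formulas over [C] true of almost all conjugates in the sense of [U]. *)
pose q : set (pformula M X) := [set phi | over C phi /\ U (holds phi)].
have Ucon K : finite_set K -> K `<=` C -> U (conjugates K).
  by move=> fK KC; apply: FU; exists K.
have q_type : complete_type C q.
  split=> [phi []//|d phi qphi|phi oC].
    have /filter_ex[x xphi] : U [set x | forall l, holds (phi l) x].
      by apply: filter_forall => l; case: (qphi l).
    by exists x.
  by have [h|h] := in_ultra_setVsetC (holds phi) uU; [left|right].
have pq : tp a N `<=` q.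
  move=> phi [oN phia]; split; first exact: subset_trans oN N_sub_C.
  apply: filterS (Ucon _ (finite_rng (@ppar _ _ _ phi)) (subset_trans oN N_sub_C)).
  move=> x [f [fa fS _ fx]]; apply/(holds_pmove _ _ fa).
  rewrite (pmove_fixes fS) ?fx // => z zphi; right; split=> //; exact: oN.
exists q; split=> // a' a'q.
have a'E := realizes_tpE q_type a'q.
split.
  (* Saturation of [C] yields one dividing formula that itself belongs to [q]. It holds at a
     conjugate [x] whose automorphism [f] sends its parameters into [N], so [f] gives a dividing
     formula over [N] true of [a]. *)
  move=> /divides_forks /(forks_divides (fun _ => id)) [phi phiA].
  rewrite a'E => -[oC Uphi].
  have /filter_ex[x [xphi [f [fa fS fN fx]]]] :
      U (holds phi `&` conjugates (rng (@ppar _ _ _ phi))).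
    by apply: filterI => //; apply: Ucon => //; exact: finite_rng.
  apply/a_nonforking/divides_forks/(@divides_of_mem _ _ _ _ _ (pmove f phi)).
    by apply: formula_divides_pmove => //; apply: fixes_sub fS; exact: subsetUl.
  split; last by rewrite -fx; apply/holds_pmove.
  by apply/rng_subP => i; apply: (fN (existT _ _ _)); exists i.
move=> [phi [phiA [d [psi [psia' psiphi]]]]]; apply: N_nondividing.
have /dep_choice[e /dep_choice[chi H]] :=
  fun l => variable_parameters (let: conj oa _ := psia' l in oa).
pose Ct := set_tuple (B := C); pose At := set_tuple (B := A).
(* [theta l] is [psi l] read as a condition on [x]: the entries of [C] become parameters, and the
   parameters from [a'] become the variables [x]. *)
have /choice[theta thetaP] : forall l, exists theta : pformula M X, over C theta /\
    forall x, holds theta x <-> sat (pbody (psi l)) (tcat Ct (e l x)).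
  move=> l; have [_ _ _ chiE] := H l; have [chi' chi'E] := csum_assoc M (chi l).
  have [theta [oth thE]] := pformula_of_params chi' (tcat At Ct).
  exists theta; split=> [|x]; last by rewrite thE chi'E chiE.
  apply: subset_trans oth _; apply/rng_subP => -[v|v] /=.
    by apply: A_sub_C; case: v => -[].
  by case: v => -[].
have /dep_choice[V /all_and2[finV VP]] := fun l => sat_support M (pbody (psi l)).
(* The finitely many entries of [C] on which the truth of the [psi l] depends. *)
pose K := \bigcup_(l in [set: 'I_d]) (sval @` (inl @^-1` V l)).
have KC : K `<=` C by move=> _ [l _ [v _ <-]]; exact: svalP.
have finK : finite_set K.
  apply: bigcup_finite => [|l _]; first exact: finite_finset.
  by apply/finite_image/(finite_preimage _ (finV l)) => x y _ _ [].
have /filter_ex[x [xtheta [f [fa fS fN fx]]]] :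
    U ([set x | forall l, holds (theta l) x] `&` conjugates K).
  apply: filterI; last exact: Ucon.
  apply: filter_forall => l; suff [] : q (theta l) by [].
  have [oC thE] := thetaP l; have [ea _ _ _] := H l.
  by rewrite -a'E; split=> //; apply/thE; rewrite ea; have [] := psia' l.
have fA : fixes A f by apply: fixes_sub fS; exact: subsetUl.
have a'a : realizes a (tp a' A).
  move=> psi0 [oA psi0a']; apply: contrapT => npsi.
  have /pq /a'q /(_ psi0a') [] : tp a N (pneg psi0).
  by split=> //; exact: subset_trans oA A_sub_N.
(* Two automorphisms play different roles: [g] takes [a'] to [a] and moves the formulas, while [f]
   takes [x] to [a] and moves the tuple that satisfies them. *)
have [g [ga gA ga']] := automorphism_extending M_monster (small_of_sub A_sub_C) a'a.
(* [h] follows [f] on the entries sent into [N], among them all of [K]; any other entry is an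
   arbitrary element of [N] of the right sort. *)
have /dep_choice[h hP] : forall v : set_ctx C, exists y : M (vsort v),
    N (existT _ (vsort v) y) /\
    (N (existT _ (vsort v) (f _ (Ct v))) -> y = f _ (Ct v)).
  move=> v; have [Nf|nNf] := pselect (N (existT _ (vsort v) (f _ (Ct v)))).
    by exists (f _ (Ct v)).
  by have [y Ny] := model_inhabited (vsort v); exists y.
apply: (divides_transfer ga gA phiA psiphi (h := h)).
  by apply/rng_subP => v; have [] := hP v.
move=> l; have [ea erng emap _] := H l.
have epar : tmap g (@ppar _ _ _ (psi l)) = e l a by rewrite -ea emap // ga'.
split; first by rewrite /over /= epar; exact: erng.
(* On the support [V l] the tuple [h] agrees with the image of [C] under [f]; what remains is the
   image under [f] of the truth of [theta l] at [x]. *)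
rewrite /holds /= epar; apply: (VP l (tcat (tmap f Ct) (e l a))).
  case=> [v|i] Vv //=; have [_ ->//] := hP v.
  by apply: (fN (sval v)); exists l => //; exists v.
rewrite -fx -emap // -tmap_tcat; apply: (proj1 (proj1 fa _ _ _)).
by have [_ thE] := thetaP l; apply/thE.
Qed.

End Extension.

(** * Necessity of the two conditions *)

Lemma strictly_free_nonforking (X : fctx L) (p : set (pformula M X))
    (a : assign M X) : complete_type N p -> strictly_free C A p -> realizes a p ->
  ~ forks A (tp a N) /\
  ~ divides A (tp (set_tuple (B := N)) (A `|` rng a)).
Proof.
move=> p_type [q [q_type pq q_strict]] ap.
have [_ _ Msat _] := M_monster.
(* [C] is small in [M], so the global type has a realization there, to which strict nondividing
   applies. *)
have [a' [_ a'q]] := Msat C (fun _ _ => I) C_small X q q_type.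
have [a'C Ca'] := q_strict a' a'q.
have a'p : realizes a' p by exact: realizes_sub a'q.
have aE := realizes_tpE p_type ap; have a'E := realizes_tpE p_type a'p.
split.
  rewrite aE -a'E => /(forks_divides N_sub_C)[phi phiA phia'].
  exact/a'C/divides_of_mem/phia'.
move=> [phi [phiA [d [psi [psia psiphi]]]]]; apply: Ca'.
have aa' : realizes a' (tp a N) by rewrite aE.
(* [g] takes [a] to [a'] and fixes [N] pointwise, so the tuple [N], now inside [C], satisfies the
   moved formulas. *)
have [g [ga gN gaa']] := automorphism_extending M_monster (small_of_sub N_sub_C) aa'.
have gA : fixes A g by exact: fixes_sub gN.
apply: (divides_transfer ga gA phiA psiphi (h := set_tuple (B := N))).
  by rewrite rng_set_tuple.
move=> l; have [opsi hpsi] := psia l.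
have [e [_ [ea erng emap _]]] := variable_parameters opsi; split.
  by rewrite /over /= -ea emap // gaa'; exact: erng.
rewrite -[X in holds _ X](tmap_fixes gN); first exact/holds_pmove.
by rewrite rng_set_tuple.
Qed.

(** * Heirs *)

Lemma heir_nondividing (X : fctx L) (p : set (pformula M X)) (a : assign M X) :
  complete_type N p -> heir A N p -> realizes a p ->
  ~ divides A (tp (set_tuple (B := N)) (A `|` rng a)).
Proof.
move=> p_type p_heir ap [phi [phiA [d [psi [psia psiphi]]]]].
have aE := realizes_tpE p_type ap.
have /dep_choice[e /dep_choice[chi H]] :=
  fun l => variable_parameters (let: conj oa _ := psia l in oa).
pose Nt := set_tuple (B := N); pose At := set_tuple (B := A).
(* The [psi l] are gathered into one formula with finite tuples: [r] lists the entries of [N] that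
   matter, [r'] the parameters from [A]. The heir property can then replace the entries of [N] by
   [y'] in [A]. *)
have [chi0 chi0E] := formula_conj M chi.
have [n [r [r_inj [chi1 chi1E]]]] := formula_fin_support M chi0.
have [chi2 chi2E] := csum_swapr M chi1.
have [m [r' [_ [chi3 chi3E]]]] := formula_fin_support M chi2.
have [chi4 chi4E] := csum_fsum M chi3.
pose z : assign M (reindex_ctx r') := fun i => At (r' i).
have zA : rng z `<=` A.
  by rewrite -[X in _ `<=` X]rng_set_tuple => _ [i ->]; exists (r' i).
have E x (y : assign M (reindex_ctx r)) :
    sat chi4 (@tcat L M X (fsum _ _) x (fcat y z)) <->
    sat chi1 (tcat (tcat x At) y) by rewrite chi4E -chi3E chi2E.
have [||y' [y'A py']] := p_heir _ _ chi4 z (fun i => Nt (r i)) zA.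
- by rewrite -[X in _ `<=` X]rng_set_tuple => _ [i ->]; exists (r i).
- rewrite -aE; split.
    apply: rng_fcat; last exact: subset_trans zA A_sub_N.
    by rewrite -[X in _ `<=` X]rng_set_tuple => _ [i ->]; exists (r i).
  apply/E/chi1E/chi0E => l; have [ea _ _ chiE] := H l.
  by apply/chiE; rewrite ea; have [] := psia l.
have chi1a : sat chi1 (tcat (tcat a At) y') by apply/E; exact: (ap _ py').
(* [h] extends [y'] to a tuple indexed by [N], arbitrarily off the range of [r]; it is well defined
   because [r] is injective. *)
have /dep_choice[h hP] : forall v : set_ctx N, exists y : M (vsort v),
    forall i (iv : r i = v), eq_rect _ (fun w : set_ctx N => M (vsort w)) (y' i) _ iv = y.
  move=> v; have [[i <-]|nv] := pselect (exists i, r i = v).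
    exists (y' i) => j ji; have ij := r_inj _ _ ji; subst j.
    by rewrite (Prop_irrelevance ji erefl).
  have [y _] := model_inhabited (vsort v); exists y => i iv.
  by case: nv; exists i.
have hr : (fun i => h (r i)) = y'.
  by apply: functional_extensionality_dep => i; rewrite -(hP _ i erefl).
have [k [b [bA]]] := phiA.
(* The first [k] conjugates are refuted by the common solution [h]. *)
move=> /(_ (@nat_of_ord k) (@ord_inj k)); apply; exists h => i.
have parb : realizes (b i) (tp (@ppar _ _ _ phi) A) by rewrite -(bA i) => ? [].
have [g [ga gA gb]] := automorphism_extending M_monster (small_of_sub A_sub_C) parb.
have [_ [g' [_ g'g]]] := ga.
suff : holds (pmove g phi) h by rewrite /holds /= gb.
rewrite -[h](tmap_cancel _ g'g); apply/holds_pmove => //; apply: psiphi => l.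
apply/(holds_pmove _ _ ga); rewrite (tmap_cancel _ g'g) /holds /=.
have [<- _ emap chiE] := H l; rewrite emap //; apply/chiE.
move: l {emap chiE}; apply/chi0E/chi1E; rewrite hr.
(* As [y'] lies in [A], it is fixed by [g], so its relation to [a] passes to the image of [a] under
   [g]. *)
have -> : y' = tmap g y' by rewrite (tmap_fixes gA).
have gAt : tmap g At = At by rewrite (tmap_fixes gA) // rng_set_tuple.
by rewrite -/At -gAt -!tmap_tcat; apply: (proj1 (proj1 ga _ _ _)).
Qed.

End Strict.

Unset Implicit Arguments.
Local Close Scope card_scope.

Theorem corollary4p6
  (L : language) (T : set (sentence L))
  (T_complete : complete_theory T) (T_dependent : dependent T)
  (T_eq : eq_closed T)
  (* the larger monster model and, inside it, the monster model *)
  (M : structure L) (M_model : model T M)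
  (C : set (elt M)) (kappa kappa' : Type)
  (C_monster : monster C kappa)
  (M_monster : monster [set: elt M] kappa')
  (C_small : card_lt C [set: kappa'])
  (A : set (elt M)) (A_sub_C : A `<=` C) (A_small : card_lt A [set: kappa])
  (N : set (elt M)) (A_sub_N : A `<=` N) (N_sub_C : N `<=` C)
  (N_model : elementary_sub N)
  (N_saturated : succ_saturated N ({x | A x} + theory_card L)%type) :
  (forall (X : fctx L) (p : set (pformula M X)), complete_type N p ->
     (strictly_free C A p <->
      forall a : assign M X, realizes a p ->
        ~ forks A (tp a N) /\
        ~ divides A (tp (set_tuple (B := N)) (A `|` rng a))))
  /\
  (forall (X : fctx L) (p : set (pformula M X)), complete_type N p ->
     (heir A N p -> ~ forks A p -> strictly_free C A p) /\
     (heir A N p -> coheir A p -> strictly_free C A p)).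
Proof.
have [_ _ Msat _] := M_monster.
have realized (X : fctx L) (p : set (pformula M X)) : complete_type N p ->
    exists2 a, realizes a p & tp a N = p.
  (* [N] lies in [C], hence is small in [M], so [p] is realized in [M]. *)
  move=> p_type; have [a [_ ap]] :=
    Msat N (fun _ _ => I) (small_of_sub C_small N_sub_C) X p p_type.
  by exists a => //; exact: realizes_tpE p_type ap.
have free_of_conditions (X : fctx L) (p : set (pformula M X)) :
    complete_type N p ->
    (forall a : assign M X, realizes a p -> ~ forks A (tp a N) /\
        ~ divides A (tp (set_tuple (B := N)) (A `|` rng a))) ->
    strictly_free C A p.
  move=> p_type h; have [a ap aE] := realized X p p_type.
  rewrite -aE; have [h1 h2] := h a ap.
  exact: (strictly_free_of_model C_monster M_monster C_small A_sub_C A_small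
    A_sub_N N_sub_C N_model N_saturated h1 h2).
have free_of_heir (X : fctx L) (p : set (pformula M X)) : complete_type N p ->
    heir A N p -> ~ forks A p -> strictly_free C A p.
  move=> p_type p_heir p_nf; apply: free_of_conditions => // a ap; split.
    by rewrite (realizes_tpE p_type ap).
  exact: (heir_nondividing M_monster C_small A_sub_C A_sub_N N_model p_type p_heir ap).
split=> X p p_type; last first.
  split=> [|p_heir p_coheir]; first exact: free_of_heir.
  by apply: free_of_heir => //; exact: coheir_nonforking.
split; last exact: free_of_conditions.
move=> p_free a ap.
exact: (strictly_free_nonforking C_monster M_monster C_small A_sub_C A_small
  A_sub_N N_sub_C p_type p_free ap).
Qed.
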